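(* Let $(X,\rho)$ be a nonempty complete metric space and let $\psi:X\to X$ be a mapping such that, for some $\alpha\in\left[0,\frac12\right)$ and some $m\in\mathbb{N}$ with $m\ge 3$, $$\rho(\psi^m x,\psi^m y)\le \alpha\left(\rho(x,\psi y)+\rho(y,\psi x)\right)\quad\text{for all } x,y\in X.$$ Then there exists a point $x^*\in X$ such that for every $x\in X$ the iterative sequence $(\psi^n x)_{n\in\mathbb{N}}$ converges in $(X,\rho)$ to $x^*$ (the same point for all $x$), and $\mathrm{Fix}(\psi)\subseteq\{x^*\}$.
   Context: For a self-mapping $\psi:X\to X$, $\psi^n$ denotes the $n$-fold composition of $\psi$ with itself, and $\mathrm{Fix}(\psi)=\{x\in X:\psi x=x\}$ is the set of fixed points of $\psi$. *)

(* Defs.v *)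
From HB Require Import structures.
From mathcomp Require Import all_boot all_order all_algebra.
From mathcomp Require Import all_classical all_reals all_analysis.

Set Implicit Arguments.
Unset Strict Implicit.
Unset Printing Implicit Defensive.

Local Open Scope classical_set_scope.

(* The library's [Complete] contains [isPointed], so these spaces are nonempty
   (and, classically, every nonempty complete metric space is of this form). *)
#[short(type="completeMetricType")]
HB.structure Definition CompleteMetric (R : realType) :=
  {X of Complete X & Metric R X}.

Definition fixed_points (X : Type) (psi : X -> X) : set X :=
  [set x | psi x = x].

(* Main.v *)
Require Import Defs.
From mathcomp Require Import all_boot all_order all_algebra.
From mathcomp Require Import all_classical all_reals all_analysis.
From mathcomp Require Import ring lra zify.

(** The point is that finitely many orbits can be treated as one bounded set
    that shrinks.  Shifting all indices by [m] in the hypothesis bounds the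
    distance of two points [psi^(m+i) x], [psi^(m+j) y] by [alpha] times a sum
    of two distances between points of earlier index on the same two orbits,
    hence by [2 alpha < 1] times any bound on such distances.

    If [C] bounds the distances among the finitely many points of index at most
    [m], the triangle inequality through a point of index [m] turns a bound [B]
    on earlier distances into the bound [C + 2 alpha B]; the number
    [B = C / (1 - 2 alpha)] is stable under this step, so it bounds all
    distances ([orbits_bounded]).  Now every shift by [m] multiplies the bound
    by [2 alpha], so the points of large index of all the orbits are uniformly
    close ([orbits_asymptotic]).  For one orbit this is the Cauchy property, for
    two orbits it says that their limits agree.  As [psi] may be discontinuous,
    the common limit need not be a fixed point; but the orbit of a fixed point
    is constant, so a fixed point can only be that limit. *)

Import Order.TTheory GRing.Theory Num.Theory.
Import numFieldNormedType.Exports.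

Local Open Scope classical_set_scope.
Local Open Scope ring_scope.

(** The orbits enter only through the sequences [z a], indexed by a finite type
    so that their initial segments together form a finite set.  As [m > 1],
    every index on the right of [z_contr] is strictly smaller than the larger
    index on its left, which makes an induction on the largest index possible. *)
Lemma orbits_bounded (R : realType) (X : metricType R) (T : finType)
    (z : T -> nat -> X) (alpha : R) (m : nat)
    (alpha_ge0 : 0 <= alpha) (alpha_lt_half : alpha < 1 / 2) (m_gt1 : (1 < m)%N)
    (z_contr : forall a b i j,
      mdist (z a (m + i)%N) (z b (m + j)%N)
        <= alpha * (mdist (z a i) (z b j.+1) + mdist (z b j) (z a i.+1))) :
  exists B : R, forall a b i j, mdist (z a i) (z b j) <= B.
Proof.
pose F (q : (T * 'I_m.+1) * (T * 'I_m.+1)) : R :=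
  mdist (z q.1.1 q.1.2) (z q.2.1 q.2.2).
pose C := \sum_q F q.
have C_ge0 : 0 <= C by apply: sumr_ge0 => q _; exact: mdist_ge0.
have initC a b i j : (i <= m)%N -> (j <= m)%N -> mdist (z a i) (z b j) <= C.
  move=> i_le_m j_le_m.
  have im : (i < m.+1)%N by rewrite ltnS.
  have jm : (j < m.+1)%N by rewrite ltnS.
  rewrite /C (bigD1 ((a, Ordinal im), (b, Ordinal jm)))//= /F/= lerDl.
  by apply: sumr_ge0 => q _; exact: mdist_ge0.
pose B := C / (1 - 2 * alpha).
have gap_gt0 : 0 < 1 - 2 * alpha by lra.
have B_stable : C + 2 * alpha * B = B.
  suff <- : B * (1 - 2 * alpha) = C by ring.
  by rewrite /B divfK// gt_eqF.
have B_ge0 : 0 <= B by rewrite divr_ge0// ltW.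
have aB_ge0 : 0 <= 2 * alpha * B.
  by apply: mulr_ge0 B_ge0; exact: mulr_ge0.
exists B => a b i j.
suff bounded n : forall a b i j, (i < n)%N -> (j < n)%N ->
    mdist (z a i) (z b j) <= B.
  apply: (bounded (i + j).+1); first by rewrite ltnS leq_addr.
  by rewrite ltnS leq_addl.
elim: n => [//|n IHn] {}a {}b {}i {}j; rewrite !ltnS => i_le_n j_le_n.
(* Two indices from [m] on gain the factor [2 alpha]; up to [m] the initial
   bound [C] applies, and a mixed pair is split at index [m]. *)
have late a' b' k l : (m <= k <= n)%N -> (m <= l <= n)%N ->
    mdist (z a' k) (z b' l) <= 2 * alpha * B.
  move=> /andP[mk kn] /andP[ml ln].
  have := z_contr a' b' (k - m)%N (l - m)%N; rewrite !subnKC// => /le_trans; apply.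
  have -> : 2 * alpha * B = alpha * (B + B) by ring.
  by rewrite ler_wpM2l// lerD// IHn//; lia.
have [im|/ltnW mi] := leqP i m; have [jm|/ltnW mj] := leqP j m.
- by apply: le_trans (initC _ _ _ _ im jm) _; lra.
- have := metric_triangle (z a i) (z a m) (z b j).
  have := initC a a i m im (leqnn m).
  have := late a b m j; rewrite leqnn mj j_le_n (leq_trans mj)// => /(_ isT isT).
  lra.
- have := metric_triangle (z a i) (z b m) (z b j).
  have := initC b b m j (leqnn m) jm.
  have := late a b i m; rewrite leqnn mi i_le_n (leq_trans mi)// => /(_ isT isT).
  lra.
- by apply: le_trans (late _ _ _ _ _ _) _; rewrite ?mi ?mj//; lra.
Qed.

(** Each shift of the indices by [m] multiplies the global bound by
    [2 alpha < 1]. *)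
Lemma orbits_asymptotic (R : realType) (X : metricType R) (T : finType)
    (z : T -> nat -> X) (alpha : R) (m : nat)
    (alpha_ge0 : 0 <= alpha) (alpha_lt_half : alpha < 1 / 2) (m_gt1 : (1 < m)%N)
    (z_contr : forall a b i j,
      mdist (z a (m + i)%N) (z b (m + j)%N)
        <= alpha * (mdist (z a i) (z b j.+1) + mdist (z b j) (z a i.+1)))
    (eps : R) (eps_gt0 : 0 < eps) :
  exists N : nat, forall a b i j, (N <= i)%N -> (N <= j)%N ->
    mdist (z a i) (z b j) < eps.
Proof.
have [B zB] := orbits_bounded _ _ _ _ _ _ alpha_ge0 alpha_lt_half m_gt1 z_contr.
have decay k : forall a b i j, (k * m <= i)%N -> (k * m <= j)%N ->
    mdist (z a i) (z b j) <= B * (2 * alpha) ^+ k.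
  elim: k => [|k IHk] a b i j; first by rewrite expr0 mulr1.
  rewrite mulSn => ki kj.
  have := z_contr a b (i - m)%N (j - m)%N.
  rewrite !subnKC; [|lia|lia] => /le_trans; apply.
  have -> : B * (2 * alpha) ^+ k.+1
      = alpha * (B * (2 * alpha) ^+ k + B * (2 * alpha) ^+ k).
    by rewrite exprS; ring.
  by rewrite ler_wpM2l// lerD// IHk//; lia.
have : geometric B (2 * alpha) @ \oo --> (0 : R).
  by apply: cvg_geometric; rewrite ger0_norm; lra.
move=> /cvgr0_norm_lt /(_ _ eps_gt0) [k _ /(_ k (leqnn k)) /= small].
exists (k * m)%N => a b i j ki kj.
apply: le_lt_trans (decay k _ _ _ _ ki kj) _.
exact: le_lt_trans (ler_norm _) small.
Qed.

Theorem corollary3p1 (R : realType) (X : completeMetricType R) (psi : X -> X)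
    (alpha : R) (m : nat)
    (alpha_ge0 : 0 <= alpha) (alpha_lt_half : alpha < 1 / 2) (m_ge3 : (3 <= m)%N)
    (psi_contr : forall x y : X,
      mdist (iter m psi x) (iter m psi y)
        <= alpha * (mdist x (psi y) + mdist y (psi x))) :
  exists xstar : X,
    (forall x : X, iter n psi x @[n --> \oo] --> xstar) /\
    fixed_points psi `<=` [set xstar].
Proof.
have asymptotic (x y : X) (eps : R) : 0 < eps -> exists N : nat,
    forall i j, (N <= i)%N -> (N <= j)%N ->
    mdist (iter i psi x) (iter j psi y) < eps.
  move=> eps_gt0.
  pose z (a : bool) n := iter n psi (if a then x else y).
  have z_contr a b i j : mdist (z a (m + i)%N) (z b (m + j)%N)
      <= alpha * (mdist (z a i) (z b j.+1) + mdist (z b j) (z a i.+1)).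
    by rewrite /z !iterD.
  have [N close] := orbits_asymptotic _ _ _ _ _ _ alpha_ge0 alpha_lt_half
    (ltnW m_ge3) z_contr _ eps_gt0.
  by exists N => i j; exact: (close true false).
have [xstar cvg_point] : exists l : X, iter n psi point @[n --> \oo] --> l.
  apply/cvg_ex; apply: cauchy_cvg; apply: cauchy_exP => eps eps_gt0.
  have [N close] := asymptotic point point eps eps_gt0.
  exists (iter N psi point), N => // n Nn /=.
  by rewrite ballEmdist/=; exact: close.
have cvg_all x : iter n psi x @[n --> \oo] --> xstar.
  apply/cvg_ballP => eps eps_gt0.
  have eps2_gt0 : 0 < eps / 2 by rewrite divr_gt0.
  have [N close] := asymptotic point x _ eps2_gt0.
  have [M _ near_xstar] := (@cvg_ballP _ _ _ _ _ _ _).1 cvg_point _ eps2_gt0.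
  exists (maxn M N) => // n /=; rewrite geq_max => /andP[Mn Nn].
  rewrite (splitr eps); apply: ball_triangle (near_xstar n Mn) _.
  by rewrite ballEmdist/=; exact: close.
exists xstar; split=> // p /= psi_p.
have orbit_p : (fun n => iter n psi p) = (fun=> p).
  by apply/funext => n; exact: iter_fix.
have := cvg_all p; rewrite orbit_p => cvg_p.
exact: (cvg_unique (@metric_hausdorff _ X) (cvg_cst p) cvg_p).
Qed.
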